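(* Let $p>t\ge 2$ be any integers, and let $\mathfrak{F}(\neg K_{1,t})$ be the family of all finite graphs without isolated vertices, except $K_{1,t}$. (i) If $p\ge 2t+1$, then $f(n,K_p|\mathfrak{F}(\neg K_{1,t}))=(1+o(1))\,\mathrm{ex}(n,K_{\lceil p/t\rceil})$ as $n\to\infty$. (ii) If $t+1\le p\le 2t$, then $f(n,K_p|\mathfrak{F}(\neg K_{1,t}))\le O(n^{2-1/t})$ as $n\to\infty$. Moreover, for all $n\ge p\ge t+1$, $f(n,K_p|\mathfrak{F}(\neg K_{1,t}))\ge (p-t-1)(n-p+t+1)+\binom{p-t-1}{2}+1$.
   Context: $K_{1,t}$ is the star with $t$ edges. $\mathrm{ex}(n,F)$ is the Turán number: the maximum number of edges in a graph of order $n$ containing no subgraph isomorphic to $F$. In an edge coloring of $K_n$ (not necessarily proper), for a copy $G'\subseteq K_n$ of a graph $G$, a color class of $G'$ is the graph (without isolated vertices) formed by all edges of $G'$ having a given color that occurs in $G'$. For a family $\mathcal{F}$ of graphs (closed under isomorphism) with $K_2\in\mathcal{F}$, and $n\ge |G|$, $f(n,G|\mathcal{F})$ is the smallest integer $m$ such that in every edge coloring of $K_n$ using at least $m$ colors there exists a copy of $G$ in which all color classes are members of $\mathcal{F}$. *)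

(* Defs.v *)
From HB Require Import structures.
From mathcomp Require Import all_boot.
From mathcomp Require Import boolp.

Set Implicit Arguments.
Unset Strict Implicit.
Unset Printing Implicit Defensive.

Record sgraph := SGraph {
  vertex :> finType;
  adj : rel vertex;
  adj_sym : symmetric adj;
  adj_irr : irreflexive adj }.

Definition graph_iso (G H : sgraph) : Prop :=
  exists2 h : G -> H, bijective h & forall x y, adj (h x) (h y) = adj x y.

Lemma complete_sym p : symmetric (fun x y : 'I_p => x != y).
Proof. by move=> x y; rewrite eq_sym. Qed.

Lemma complete_irr p : irreflexive (fun x y : 'I_p => x != y).
Proof. by move=> x; rewrite eqxx. Qed.

Definition complete (p : nat) : sgraph :=
  SGraph (@complete_sym p) (@complete_irr p).

Lemma star_sym t :
  symmetric (fun x y : 'I_t.+1 => (x == ord0) (+) (y == ord0)).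
Proof. by move=> x y; rewrite addbC. Qed.

Lemma star_irr t :
  irreflexive (fun x y : 'I_t.+1 => (x == ord0) (+) (y == ord0)).
Proof. by move=> x; rewrite addbb. Qed.

(* K_{1,t}, with centre 0 and leaves 1, ..., t. *)
Definition star (t : nat) : sgraph := SGraph (@star_sym t) (@star_irr t).

Section EdgeGraph.
Variables (V : finType) (E : {set {set V}}).

Definition edge_adj : rel {x : V | x \in cover E} :=
  fun x y => (x != y) && ([set val x; val y] \in E).

Lemma edge_adj_sym : symmetric edge_adj.
Proof. by move=> x y; rewrite /edge_adj eq_sym setUC. Qed.

Lemma edge_adj_irr : irreflexive edge_adj.
Proof. by move=> x; rewrite /edge_adj eqxx. Qed.

(* When E consists of 2-sets, this is the graph with edge set E whose vertices
   are exactly the endpoints of the edges; it has no isolated vertices. *)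
Definition edge_graph : sgraph := SGraph edge_adj_sym edge_adj_irr.

End EdgeGraph.

Definition Kedges (n : nat) : {set {set 'I_n}} :=
  [set e : {set 'I_n} | #|e| == 2].

(* Edge set of the copy of G placed by an injective vertex map h. *)
Definition copy_edges (n : nat) (G : sgraph) (h : G -> 'I_n) :
    {set {set 'I_n}} :=
  [set [set h z.1; h z.2] | z in [pred z : G * G | adj z.1 z.2]].

(* Maximum of #|E| over the edge sets E of graphs on 'I_n with no subgraph
   isomorphic to F. *)
Definition turan (n : nat) (F : sgraph) : nat :=
  \max_(E : {set {set 'I_n}} |
        (E \subset Kedges n) &&
        ~~ [exists h : {ffun F -> 'I_n},
              injectiveb h && (copy_edges h \subset E)]) #|E|.

(* An edge colouring of K_n is a function c : {set 'I_n} -> nat, of which only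
   the values on Kedges n matter. *)
Definition colors (n : nat) (c : {set 'I_n} -> nat) (E : {set {set 'I_n}}) :
    seq nat :=
  undup [seq c e | e in E].

Definition color_class (n : nat) (c : {set 'I_n} -> nat)
    (E : {set {set 'I_n}}) (k : nat) : sgraph :=
  edge_graph [set e in E | c e == k].

Definition forces (n : nat) (G : sgraph) (Fam : sgraph -> Prop) (m : nat) :
    Prop :=
  forall c : {set 'I_n} -> nat, m <= size (colors c (Kedges n)) ->
  exists2 h : G -> 'I_n, injective h &
    forall k, k \in colors c (copy_edges h) ->
      Fam (color_class c (copy_edges h) k).

(* No colouring uses more than #|Kedges n| colours, so the minimum defining
   fnum always exists. *)
Lemma forces_ex (n : nat) (G : sgraph) (Fam : sgraph -> Prop) :
  exists m, `[< forces n G Fam m >].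
Proof.
exists #|Kedges n|.+1; apply/asboolP => c lec; exfalso.
have := leq_trans lec (size_undup _).
by rewrite size_image ltnn.
Qed.

(* f(n, G | Fam) *)
Definition fnum (n : nat) (G : sgraph) (Fam : sgraph -> Prop) : nat :=
  ex_minn (forces_ex n G Fam).

Definition no_isolated (G : sgraph) : Prop :=
  forall x : G, exists y : G, adj x y.

(* The family of all finite graphs without isolated vertices, except K_{1,t} *)
Definition fam_not_star (t : nat) (H : sgraph) : Prop :=
  no_isolated H /\ ~ graph_iso H (star t).

Definition ceil_div (m d : nat) : nat := (m + d.-1) %/ d.

Lemma ceil_divP (m d k : nat) :
  0 < d -> (ceil_div m d <= k) = (m <= k * d).
Proof.
case: d => // d _; rewrite /ceil_div /= -ltnS ltn_divLR //.
by rewrite mulSn addnC addSn ltnS leq_add2l.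
Qed.

(* Main.v *)
Require Import Defs.
From HB Require Import structures.
From mathcomp Require Import all_boot.
From mathcomp Require Import boolp.
From mathcomp Require Import zify.

(** The lower bounds come from one construction.  Split the vertices of [K_n]
    into parts, give the edges between distinct parts pairwise distinct colors,
    and color each edge inside a part by its larger end.  If [t + 1] vertices of
    a copy of [K_p] lie in one part, then one of them has exactly [t] smaller
    ones in that part of the copy, and its color class is a star with [t] edges.
    So the number of cross edges is too small a number of colors
    ([card_cross_lt_fnum]).  With [p - t - 1] singletons and one large part this
    is the explicit bound.  With [r] parts, [r * t < p], the number of cross
    edges can be made at least the Turan number of [K_(r + 1)], because every
    graph without [K_(r + 1)] is dominated by an [r]-partite one
    ([degree_majorization]).

    For the upper bounds, choose one edge of each color; the chosen edges form a
    rainbow graph [E].  Look for a set of [p] vertices split into parts of size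
    at most [t], with all cross edges in [E].  Since colors are not repeated on
    [E], a star with [t] edges of one color would consist of the edges from its
    center [x] to the [t - 1] other vertices of its part and a single cross edge
    at [x].  For fixed [x] and the color prescribed by one edge inside the part,
    at most one neighbor of [x] in [E] can complete such a star.  Hence, when one
    vertex varies and the others are fixed, only a bounded number of its values
    are bad, and exchanging the value of one coordinate ([coordinate_swap]) shows
    that among many candidates for each coordinate most choices are good.

    If [E] has more than [(1 + o(1))] times as many edges as the Turan number of
    [K_(r + 1)], then it has a subset of the vertices in which every vertex
    misses a proportion smaller than [1 / r] ([dense_core]), and therefore
    contains complete [(r + 1)]-partite graphs with arbitrarily large parts
    ([blowup_in_core]).  All choices of [t] vertices in each part are then
    candidates ([good_config_of_blowup]).

    For [p <= 2 * t] there are two parts, and the candidates are the pairs of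
    [t]-tuples completely joined by [E].  Once [E] has at least [C * n ^ (2 - 1/t)] edges,
    convexity gives so many such pairs that those in which a tuple has a bounded
    number of common neighbors are negligible ([exists_clash_free]); in the
    others each coordinate has many possible values. *)

Set Implicit Arguments.
Unset Strict Implicit.
Unset Printing Implicit Defensive.

(** * Stars as color classes *)

Lemma pair_set_inj (T : finType) (v x y : T) :
  [set v; x] = [set v; y] -> x = y.
Proof.
move=> e; have : x \in [set v; y] by rewrite -e !inE eqxx orbT.
rewrite !inE => /orP[/eqP xv|/eqP //]; have : y \in [set v; x].
  by rewrite e !inE eqxx orbT.
by rewrite !inE xv orbb => /eqP.
Qed.

Lemma star_edge_graph (T : finType) (v : T) (Z : {set T}) (t : nat) :
  v \notin Z -> #|Z| = t -> 0 < t ->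
  graph_iso (edge_graph [set [set v; u] | u in Z]) (star t).
Proof.
move=> vZ cZ t0; set F := imset _ _.
have cvF : cover F = v |: Z.
  apply/setP => x; apply/bigcupP/setU1P.
    move=> [_ /imsetP[u uZ ->]]; rewrite !inE => /orP[/eqP->|/eqP->]; first by left.
    by right.
  have [u uZ] : exists u, u \in Z by apply/card_gt0P; rewrite cZ.
  case=> [->|xZ]; [exists [set v; u]|exists [set v; x]];
    by rewrite ?inE ?eqxx ?orbT //; apply: imset_f.
pose s := v :: enum Z.
have ss : size s = t.+1 by rewrite /= -cardE cZ.
have us : uniq s by rewrite /= mem_enum vZ enum_uniq.
have mem_s (x : {x | x \in cover F}) : val x \in s.
  by case: x => x /=; rewrite cvF !inE mem_enum.
pose f (x : {x | x \in cover F}) : 'I_t.+1 := inord (index (val x) s).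
have fE x : f x = index (val x) s :> nat.
  by rewrite inordK // -ss index_mem mem_s.
have f0 x : (f x == ord0) = (val x == v).
  by rewrite -val_eqE /= fE /= [RHS]eq_sym; case: (v == _).
have finj : injective f.
  move=> x y /(congr1 val) /=; rewrite !fE => e; apply: val_inj.
  by rewrite -(nth_index v (mem_s x)) e nth_index // mem_s.
exists f.
  apply: inj_card_bij => //.
  rewrite card_ord card_sig.
  rewrite (@eq_card _ _ (mem (v |: Z))); last by move=> x; rewrite -cvF.
  by rewrite cardsU1 vZ cZ.
move=> x y; rewrite /= /edge_adj !f0 -(inj_eq val_inj).
move: (val x) (val y) (mem_s x) (mem_s y) => {}x {}y.
rewrite !inE !mem_enum.
have [->|xv] /= := eqVneq x v; have [->|yv] //= := eqVneq y v.
- by move=> _ yZ; apply/esym/imset_f.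
- by move=> xZ _; rewrite xv setUC; apply/esym/imset_f.
move=> xZ yZ; apply/esym/negP => /andP[_] /imsetP[u _ /setP/(_ v)].
by rewrite !inE eqxx (eq_sym v x) (negPf xv) (eq_sym v y) (negPf yv).
Qed.

(** * A coloring forcing a star into every copy of the complete graph *)

Definition cross_edges (n : nat) (K : eqType) (pi : 'I_n -> K) : {set {set 'I_n}} :=
  [set e in Kedges n | [exists x in e, exists y in e, pi x != pi y]].

(** The shift by [n] keeps the colors of the cross edges, which are pairwise
    distinct, away from the colors inside the parts.  Inside a part, the class
    of [v] in a copy is the star from [v] to the smaller vertices of that copy
    in the same part. *)
Definition part_coloring (n : nat) (K : eqType) (pi : 'I_n -> K) (e : {set 'I_n}) : nat :=
  if e \in cross_edges pi then n + enum_rank e else \max_(x in e) x.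

Lemma cross_edges_pair (n : nat) (K : eqType) (pi : 'I_n -> K) (x y : 'I_n) :
  ([set x; y] \in cross_edges pi) = (pi x != pi y).
Proof.
rewrite !inE cards2; have [->|xy] := eqVneq x y; first by rewrite eqxx.
apply/existsP/idP => [[a]|pxy].
  rewrite !inE => /andP[/orP[]/eqP-> /existsP[b]];
  rewrite !inE => /andP[/orP[]/eqP->] //; rewrite ?eqxx // eq_sym //.
by exists x; rewrite !inE eqxx; apply/existsP; exists y; rewrite !inE eqxx orbT.
Qed.

(** Removing the largest element does not change the ranks of the others, so the
    ranks in [X] fill the interval from [0] to [#|X| - 1]. *)
Lemma exact_rank (n t : nat) (X : {set 'I_n}) :
  t < #|X| -> exists2 v, v \in X & #|[set u in X | u < v]| = t.
Proof.
have [m] := ubnP #|X|; elim: m X => // m IH X; rewrite ltnS => Xm tX.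
have [x0 x0X] : exists x, x \in X by apply/card_gt0P; apply: leq_ltn_trans tX.
case: (@arg_maxnP _ x0 (mem X) (fun x => x : nat) x0X) => v vX vmax.
have {}vX : v \in X by [].
have cX := cardsD1 v X; rewrite vX in cX.
have [tE|tX'] := eqVneq t #|X :\ v|.
  exists v => //; rewrite tE; apply: eq_card => u; rewrite !inE andbC.
  case uX: (u \in X); rewrite ?andbF ?andbT //.
  by rewrite -val_eqE /=; have /= := vmax u uX; lia.
have [||w] := IH (X :\ v); [lia|lia|].
rewrite !inE => /andP[wv wX] cw; exists w => //; rewrite -cw.
apply: eq_card => u; rewrite !inE.
have [->|//] := eqVneq u v; by have wle : w <= v := vmax w wX; rewrite ltnNge wle andbF.
Qed.

Lemma fnum_gt (n : nat) (G : sgraph) (Fam : sgraph -> Prop) (m : nat) :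
  (m < fnum n G Fam) <-> ~ forces n G Fam m.
Proof.
rewrite /fnum; case: ex_minnP => k /asboolP fk kmin; split.
  by move=> mk /asboolP/kmin; rewrite leqNgt mk.
move=> fm; rewrite ltnNge; apply/negP => km; apply: fm => c mc.
by apply: fk; apply: leq_trans mc.
Qed.

(** Among more than [t] vertices of a copy lying in one part, some [v] has exactly
    [t] smaller ones.  For [part_coloring], the class of color [v] in this copy
    is then exactly a star with [t] edges, so the coloring, which uses a color
    for each cross edge, contains no admissible copy. *)
Lemma card_cross_lt_fnum (n p t : nat) (K : eqType) (pi : 'I_n -> K) :
  0 < t ->
  (forall X : {set 'I_n}, #|X| = p ->
     exists k, t < #|[set x in X | pi x == k]|) ->
  #|cross_edges pi| < fnum n (complete p) (fam_not_star t).
Proof.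
move=> t0 big; apply/fnum_gt => /(_ (part_coloring pi)) [].
  have <- : size [seq part_coloring pi e | e in cross_edges pi] = #|cross_edges pi|.
    by rewrite size_image.
  apply: uniq_leq_size.
    rewrite map_inj_in_uniq ?enum_uniq // => e e'.
    rewrite !mem_enum /part_coloring => -> -> /addnI.
    by move/val_inj/enum_rank_inj.
  move=> _ /imageP[e eE ->]; rewrite mem_undup; apply: image_f.
  by move: eE; rewrite inE => /andP[].
move=> h hinj hF.
have [k] : exists k, t < #|[set x in [set h i | i : 'I_p] | pi x == k]|.
  by apply: big; rewrite card_imset // card_ord.
move=> /exact_rank[v]; rewrite !inE => /andP[hv /eqP pv].
set Z := [set u in _ | _] => cZ.
have vZ : v \notin Z by rewrite !inE ltnn andbF.
have ZE u : (u \in Z) = [&& u \in [set h i | i : 'I_p], pi u == k & u < v].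
  by rewrite !inE andbA.
have cE : [set e in copy_edges h | part_coloring pi e == v] = [set [set v; u] | u in Z].
  apply/setP => e; rewrite inE; apply/andP/imsetP.
    move=> [/imsetP[[i j]]]; rewrite inE /= => ij -> {e}.
    rewrite /part_coloring cross_edges_pair.
    case: ifPn; first by move=> _ /eqP; have := ltn_ord v; lia.
    rewrite negbK => /eqP pij.
    have hij : h i != h j by rewrite (inj_eq hinj).
    rewrite big_setU1 ?inE //= big_set1 => /eqP mv.
    (* The color of an edge inside a part names its larger end: call it [h i]. *)
    wlog ji : i j ij pij hij mv / h j < h i.
      move=> wl; have [ji|] := ltnP (h j) (h i); first exact: wl.
      rewrite leq_eqVlt -val_eqE in hij *; rewrite (negPf hij) /= => ij'.
      rewrite setUC; apply: wl; rewrite // 1?eq_sym // maxnC //.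
    have vi : v = h i by apply: val_inj => /=; lia.
    exists (h j); last by rewrite vi.
    by rewrite ZE imset_f //= vi ji -pij -vi pv eqxx.
  move=> [u]; rewrite ZE => /and3P[/imsetP[j _ uj] /eqP pu uv] ->.
  have [i _ vi] := imsetP hv; split.
    apply/imsetP; exists (i, j); rewrite ?vi ?uj //= inE /=.
    by apply/eqP => ij; move: uv; rewrite vi uj ij ltnn.
  rewrite /part_coloring cross_edges_pair pv pu eqxx /=.
  rewrite big_setU1 ?inE /= ?big_set1; last by apply/eqP => vu; rewrite vu ltnn in uv.
  by apply/eqP; lia.
have [] := hF v.
  rewrite mem_undup.
  have [u uZ] : exists u, u \in Z by apply/card_gt0P; rewrite cZ.
  have : [set v; u] \in [set e in copy_edges h | part_coloring pi e == v].
    by rewrite cE; apply/imsetP; exists u.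
  by rewrite inE => /andP[eh /eqP <-]; apply: image_f.
by move=> _; apply; rewrite /color_class cE; apply: star_edge_graph.
Qed.

(** * Rainbow graphs and good configurations *)

Lemma rainbow_subset (n : nat) (c : {set 'I_n} -> nat) (F : {set {set 'I_n}}) :
  exists E : {set {set 'I_n}},
    [/\ E \subset F, {in E &, injective c} & size (colors c F) <= #|E|].
Proof.
pose rep k := [pick e in F | c e == k].
exists [set e in F | rep (c e) == Some e]; split.
- by apply/subsetP => e; rewrite inE => /andP[].
- move=> e e'; rewrite !inE => /andP[_ /eqP re] /andP[_ /eqP re'] ce.
  by move: re; rewrite ce re' => -[].
rewrite cardE -(size_map c); apply: uniq_leq_size (undup_uniq _) _ => k.
rewrite mem_undup => /imageP[e eF ->].
have : rep (c e) = rep (c e) by [].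
rewrite {2}/rep; case: pickP => [e' /andP[e'F /eqP ce] re|/(_ e)]; last first.
  by rewrite [_ \in _]eF eqxx.
by rewrite -ce; apply: map_f; rewrite mem_enum inE e'F ce re eqxx.
Qed.

(** The vertices of a would-be copy, split into parts by [pi].  A color occurs at
    most once on the rainbow set [E], which contains all cross edges, so a star
    with [t] edges of one color in a configuration with parts of size at most
    [t] must consist of all the edges from its center to the rest of its part
    and one cross edge.  The last clause excludes this. *)
Definition good_config (n : nat) (c : {set 'I_n} -> nat) (E : {set {set 'I_n}})
    (Q : finType) (K : eqType) (pi : Q -> K) (h : Q -> 'I_n) : Prop :=
  [/\ forall a b, pi a != pi b -> [set h a; h b] \in E,
      injective h &
      forall a b q, a != b -> pi a = pi b -> pi q != pi a ->
        c [set h a; h b] != c [set h a; h q]].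

(** Let the class of a color be a star with [t] edges and center [h a].  Two of
    its leaves outside the part of [a] would give two edges of the rainbow set
    [E] with equal colors, and one leaf inside and one outside would contradict
    the last clause of [good_config].  As [t > 1], all [t] leaves lie in the part of [a], which
    therefore has more than [t] elements. *)
Lemma good_config_copy (n p t : nat) (c : {set 'I_n} -> nat)
    (E : {set {set 'I_n}}) (Q : finType) (K : eqType) (pi : Q -> K)
    (h : Q -> 'I_n) :
  1 < t -> p <= #|Q| -> {in E &, injective c} ->
  (forall a, #|[set b | pi b == pi a]| <= t) ->
  good_config c E pi h ->
  exists2 g : complete p -> 'I_n, injective g &
    forall k, k \in colors c (copy_edges g) ->
      fam_not_star t (color_class c (copy_edges g) k).
Proof.
move=> t1 pQ cinj small [hE hinj hc].
pose iota (i : 'I_p) : Q := enum_val (widen_ord pQ i).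
have iinj : injective iota.
  by move=> i j /enum_val_inj/(congr1 val)/= ij; apply: val_inj.
exists (fun i : complete p => h (iota i)).
  by move=> i j /hinj/iinj.
move=> k _; rewrite /color_class; set F := finset _.
have FE e : e \in F -> exists a b : Q, [/\ a != b, e = [set h a; h b] & c e = k].
  rewrite inE => /andP[/imsetP[[i j]]]; rewrite inE /= => ij -> /eqP ck.
  by exists (iota i), (iota j); rewrite (inj_eq iinj).
split.
  move=> [x xF]; have /bigcupP[e eF xe] := xF.
  have [a [b [ab eab _]]] := FE e eF.
  have hab : h a != h b by rewrite (inj_eq hinj).
  have aF : h a \in cover F by apply/bigcupP; exists e; rewrite // eab !inE eqxx.
  have bF : h b \in cover F by apply/bigcupP; exists e; rewrite // eab !inE eqxx orbT.
  move: xe; rewrite eab !inE => /orP[]/eqP xE.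
    by exists (@exist _ (fun z => z \in cover F) _ bF);
      rewrite /= /edge_adj -val_eqE /= xE hab -eab.
  by exists (@exist _ (fun z => z \in cover F) _ aF);
    rewrite /= /edge_adj -val_eqE /= xE eq_sym hab setUC -eab.
move=> [f [g fK gK] fadj].
pose v := val (g ord0).
pose u (i : 'I_t) := val (g (lift ord0 i)).
have uinj : injective u.
  by move=> i j /val_inj/(can_inj gK)/lift_inj.
have uF i : [set v; u i] \in F.
  have : edge_adj (g ord0) (g (lift ord0 i)).
    by rewrite -[edge_adj _ _]fadj !gK.
  by case/andP.
have im_h x e : e \in F -> x \in e -> exists a, x = h a.
  by move=> /FE[a [b [_ -> _]]]; rewrite !inE => /orP[]/eqP->; [exists a|exists b].
have [a va] : exists a, v = h a.
  by apply: (im_h _ _ (uF (Ordinal (ltnW t1)))); rewrite !inE eqxx.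
have /fin_all_exists[b ub] i : exists b, u i = h b.
  by apply: (im_h _ _ (uF i)); rewrite !inE eqxx orbT.
have binj : injective b by move=> i j bij; apply: uinj; rewrite !ub bij.
have cu i : c [set h a; h (b i)] = k.
  by have := uF i; rewrite -va -ub inE => /andP[_ /eqP].
have ba i : a != b i.
  apply/eqP => ab; have [a' [b' [ab' e _]]] := FE _ (uF i).
  have := cards2 (h a') (h b').
  by rewrite -e va ub -ab setUid cards1 (inj_eq hinj) ab'.
have [/existsP[i ip]|] := boolP [exists i, pi (b i) != pi a].
  have [/existsP[j /eqP jp]|] := boolP [exists j, pi (b j) == pi a].
    by have := hc _ _ _ (ba j) (esym jp) ip; rewrite !cu eqxx.
  rewrite negb_exists => /forallP np.
  have hEi i' : [set h a; h (b i')] \in E by apply: hE; rewrite eq_sym np.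
  have := cinj _ _ (hEi (Ordinal t1)) (hEi (Ordinal (ltnW t1))).
  by rewrite !cu => /(_ erefl)/pair_set_inj/hinj/binj/(congr1 val).
rewrite negb_exists => /forallP np.
have := small a; rewrite leqNgt => /negP; apply.
have -> : t.+1 = #|a |: [set b i | i : 'I_t]|.
  rewrite cardsU1 card_imset // card_ord.
  by case: imsetP => // -[i _ ai]; have := ba i; rewrite ai eqxx.
apply/subset_leq_card/subsetP => x /setU1P[->|/imsetP[i _ ->]]; rewrite inE //.
by have := np i; rewrite negbK.
Qed.

(** * Counting by exchanging one coordinate *)

Definition upd (Q T : finType) (h : {ffun Q -> T}) (q : Q) (y : T) : {ffun Q -> T} :=
  [ffun r => if r == q then y else h r].

Lemma card_pair_sum (A B : finType) (P : pred A) (R : A -> pred B) :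
  #|[set z : A * B | P z.1 && R z.1 z.2]| = \sum_(x | P x) #|[set y | R x y]|.
Proof.
rewrite -sum1_card; under [RHS]eq_bigr => x _ do rewrite -sum1_card.
rewrite pair_big_dep /=; apply: eq_bigl => z.
by rewrite !inE.
Qed.

(** The map sending [(h, y)] to [(h with y at q, h q)] is an involution.  It sends
    a pair of a member of [B] and a value in [U q] to a pair [(g, z)] in which
    [z] is one of the at most [M] values that put [g] into [B].  So if few values
    of the coordinate [q] are bad for each choice of the other coordinates,
    then only a proportion [M / #|U q|] of the whole family is bad. *)
Lemma coordinate_swap (Q T : finType) (U : Q -> {set T}) (B : {set {ffun Q -> T}})
    (q : Q) (M : nat) :
  B \subset family (fun r => mem (U r)) ->
  (forall g, g \in family (fun r => mem (U r)) -> #|[set z | upd g q z \in B]| <= M) ->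
  #|U q| * #|B| <= M * #|family (fun r => mem (U r))|.
Proof.
move=> /subsetP BH BM; set H := family _ in BH BM *.
pose f (z : {ffun Q -> T} * T) := (upd z.1 q z.2, z.1 q).
have ff : cancel f f.
  move=> [h y]; rewrite /f /= ffunE eqxx; congr pair.
  by apply/ffunP => r; rewrite !ffunE; case: eqP => [->|].
rewrite mulnC -cardsX -(card_imset _ (can_inj ff)).
apply: (@leq_trans #|[set z : {ffun Q -> T} * T | (z.1 \in H) && (upd z.1 q z.2 \in B)]|).
  apply/subset_leq_card/subsetP => _ /imsetP[[h y]] /setXP[hB yU] ->.
  rewrite inE /=; apply/andP; split.
    apply/familyP => r; rewrite ffunE; case: eqP => [->|_] //.
    by have /familyP := BH _ hB; apply.
  suff -> : upd (upd h q y) q (h q) = h by [].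
  by apply/ffunP => r; rewrite !ffunE; case: eqP => [->|].
rewrite (card_pair_sum (mem H) (fun g z => upd g q z \in B)).
rewrite mulnC -sum_nat_const; apply: leq_sum => g; exact: BM.
Qed.

Lemma card_bigcup_leq (I T : finType) (P : pred I) (F : I -> {set T}) :
  #|\bigcup_(i | P i) F i| <= \sum_(i | P i) #|F i|.
Proof.
by apply: (big_ind2 (fun (X : {set T}) k => #|X| <= k)) => //;
  [rewrite cards0|move=> X k Y l Xk Yl; apply: leq_trans (leq_card_setU _ _) (leq_add Xk Yl)].
Qed.

Lemma card_exists_le (I T : finType) (P : I -> pred T) (m : nat) :
  (forall i, #|[set z | P i z]| <= m) ->
  #|[set z | [exists i, P i z]]| <= #|I| * m.
Proof.
move=> Pm; have -> : [set z | [exists i, P i z]] = \bigcup_i [set z | P i z].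
  apply/setP => z; rewrite inE; apply/existsP/bigcupP => [[i Pi]|[i _]].
    by exists i; rewrite ?inE.
  by rewrite inE => Pi; exists i.
rewrite -sum_nat_const; apply: (@leq_trans (\sum_i #|[set z | P i z]|)); last exact: leq_sum.
exact: card_bigcup_leq.
Qed.

Lemma card_rainbow_color (n : nat) (c : {set 'I_n} -> nat) (E : {set {set 'I_n}})
    (x : 'I_n) (k : nat) :
  {in E &, injective c} ->
  #|[set z | ([set x; z] \in E) && (c [set x; z] == k)]| <= 1.
Proof.
move=> cinj; apply/card_le1_eqP => y z; rewrite !inE.
move=> /andP[yE /eqP yk] /andP[zE /eqP zk].
by apply: (pair_set_inj (v := x)); apply: cinj => //; rewrite yk zk.
Qed.

(** The values of one vertex that make it coincide with some [g i], or join it to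
    some [x j] by a rainbow edge of the same color as the fixed edge from [x j]
    to [x' j]: for each [j] the color determines that rainbow edge. *)
Lemma card_clash_values (n : nat) (c : {set 'I_n} -> nat) (E : {set {set 'I_n}})
    (I J : finType) (g : I -> 'I_n) (x x' : J -> 'I_n) :
  {in E &, injective c} ->
  #|[set z | [exists i, z == g i] ||
       [exists j, ([set x j; z] \in E) && (c [set x j; z] == c [set x j; x' j])]]|
    <= #|I| + #|J|.
Proof.
move=> cinj; pose S1 := [set z | [exists i, z == g i]].
pose S2 := [set z | [exists j,
  ([set x j; z] \in E) && (c [set x j; z] == c [set x j; x' j])]].
have S1I : #|S1| <= #|I|.
  rewrite -[#|I|]muln1; apply: (card_exists_le (P := fun i z => z == g i)) => i.
  by rewrite cardsE card1.
have S2J : #|S2| <= #|J|.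
  rewrite -[#|J|]muln1; apply: card_exists_le => j.
  exact: card_rainbow_color.
apply: leq_trans (leq_trans (leq_card_setU S1 S2) (leq_add S1I S2J)).
by apply/subset_leq_card/subsetP => z; rewrite !inE.
Qed.

Lemma card_fst_fiber (K : finType) (t : nat) (k : K) :
  #|[set q : K * 'I_t | q.1 == k]| = t.
Proof.
have pinj : injective (@pair K 'I_t k) by move=> i j [].
rewrite -[RHS]card_ord -cardsT -(card_imset (mem [set: 'I_t]) pinj).
apply: eq_card => -[k' i]; rewrite inE /=; apply/eqP/imsetP => [->|[j _ [-> _]]] //.
by exists i; rewrite ?inE.
Qed.

(** * Power means and degree sums *)

Lemma leq_expn2r (t m n : nat) : m <= n -> m ^ t <= n ^ t.
Proof. by case: t => // t; rewrite leq_exp2r. Qed.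

(** Chebyshev's sum inequality for the similarly ordered families [a] and
    [a ^ t]: compare the terms of the two double sums for [(i, j)] and [(j, i)]
    together. *)
Lemma chebyshev_pow (I : finType) (a : I -> nat) (t : nat) :
  (\sum_i a i) * (\sum_i a i ^ t) <= #|I| * \sum_i a i ^ t.+1.
Proof.
have dbl (f : I -> I -> nat) :
    \sum_i \sum_j (f i j + f j i) = 2 * \sum_i \sum_j f i j.
  under eq_bigr do rewrite big_split.
  by rewrite big_split /= [X in _ + X]exchange_big /= mul2n -addnn.
rewrite -(leq_pmul2l (m := 2)) //.
have -> : (\sum_i a i) * (\sum_i a i ^ t) = \sum_i \sum_j a i * a j ^ t.
  by rewrite big_distrl /=; under eq_bigr do rewrite big_distrr.
have -> : #|I| * \sum_i a i ^ t.+1 = \sum_i \sum_(j : I) a i ^ t.+1.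
  by rewrite big_distrr /=; under [RHS]eq_bigr do rewrite sum_nat_const.
rewrite -!dbl; apply: leq_sum => i _; apply: leq_sum => j _; rewrite !expnS.
have [ij|/ltnW ij] := leqP (a i) (a j); have := leq_expn2r t ij; nia.
Qed.

Lemma power_mean (I : finType) (a : I -> nat) (t : nat) :
  (\sum_i a i) ^ t.+1 <= #|I| ^ t * \sum_i a i ^ t.+1.
Proof.
elim: t => [|t IH]; first by rewrite mul1n.
rewrite expnS (leq_trans (leq_mul (leqnn _) IH)) //.
by rewrite mulnCA expnSr -mulnA leq_mul // chebyshev_pow.
Qed.

Lemma sum_degrees (T : finType) (E : {set {set T}}) :
  (forall e, e \in E -> #|e| = 2) ->
  \sum_x #|[set y | [set x; y] \in E]| = 2 * #|E|.
Proof.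
move=> E2.
rewrite -(card_pair_sum xpredT (fun x y : T => [set x; y] \in E)) /=.
rewrite -sum1_card (partition_big (fun z : T * T => [set z.1; z.2]) (mem E)) /=; last first.
  by move=> z; rewrite inE.
rewrite mulnC -sum_nat_const; apply: eq_bigr => e eE.
rewrite sum1dep_card; have /eqP/cards2P[x [y [xy exy]]] := E2 e eE.
transitivity #|[set (x, y); (y, x)]|; last by rewrite cards2 xpair_eqE (negPf xy).
apply: eq_card => -[u v]; rewrite !inE /= !xpair_eqE.
apply/andP/orP => [[_ /eqP euv]|].
  have : x \in [set u; v] by rewrite euv exy !inE eqxx.
  have : y \in [set u; v] by rewrite euv exy !inE eqxx orbT.
  rewrite !inE => /orP[]/eqP yE /orP[]/eqP xE; move: xy; rewrite xE yE ?eqxx //.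
    by move=> _; right.
  by move=> _; left.
by case=> /andP[/eqP -> /eqP ->]; rewrite ?[[set y; x]]setUC -exy eqxx eE.
Qed.

(** * The range of exponent 2 - 1/t: pairs of completely joined tuples *)

Section TwoSides.
Variables (n t : nat) (c : {set 'I_n} -> nat) (E : {set {set 'I_n}}).
Hypothesis cinj : {in E &, injective c}.

Definition common_nbrs (x : {ffun 'I_t -> 'I_n}) : {set 'I_n} :=
  [set y | [forall a, [set x a; y] \in E]].

(** The obstruction to a good configuration, charged to the coordinate [b] of [w]:
    given [x] and the other coordinates of [w], few common neighbors of [x] in
    the place of [w b] produce it. *)
Definition clash (x w : {ffun 'I_t -> 'I_n}) (b : 'I_t) : bool :=
  [exists r, (r != b) && (w r == w b)] ||
  [exists a : 'I_t * 'I_t,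
     (a.1 != a.2) && (c [set x a.1; x a.2] == c [set x a.1; w b])].

Definition joined (z : {ffun 'I_t -> 'I_n} * {ffun 'I_t -> 'I_n}) : bool :=
  [forall a, forall b, [set z.1 a; z.2 b] \in E].

Lemma joinedE x w : joined (x, w) = (w \in ffun_on (mem (common_nbrs x))).
Proof.
apply/forallP/ffun_onP => [j b|j a].
  by rewrite inE; apply/forallP => a; have /forallP := j a; apply.
by apply/forallP => b; have := j b; rewrite inE => /forallP.
Qed.

Lemma joined_sym x w : joined (x, w) = joined (w, x).
Proof.
suff imp x' w' : joined (x', w') -> joined (w', x') by apply/idP/idP; apply: imp.
move=> /forallP j; apply/forallP => a; apply/forallP => b /=.
by have /forallP/(_ a) := j b; rewrite setUC.
Qed.

(** All coordinates of [w] range independently over the common neighbors of [x]. *)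
Lemma card_joined :
  #|[set z | joined z]| = \sum_x #|common_nbrs x| ^ t.
Proof.
transitivity #|[set z : {ffun 'I_t -> 'I_n} * {ffun 'I_t -> 'I_n} |
  true && (z.2 \in ffun_on (mem (common_nbrs z.1)))]|.
  by apply: eq_card => -[x w]; rewrite !inE joinedE.
rewrite (card_pair_sum xpredT (fun x w => w \in ffun_on (mem (common_nbrs x)))).
by apply: eq_bigr => x _; rewrite cardsE card_ffun_on card_ord.
Qed.

(** Double counting of the stars with center [y] and leaves [x]. *)
Lemma sum_common_nbrs :
  \sum_x #|common_nbrs x| = \sum_y #|[set x | [set y; x] \in E]| ^ t.
Proof.
pose R (x : {ffun 'I_t -> 'I_n}) y := [forall a, [set x a; y] \in E].
rewrite -(card_pair_sum xpredT R).
have swap : injective (fun z : {ffun 'I_t -> 'I_n} * 'I_n => (z.2, z.1)).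
  by move=> [x y] [x' y'] [-> ->].
rewrite -(card_imset _ swap).
transitivity #|[set z : 'I_n * {ffun 'I_t -> 'I_n} | true && (R z.2 z.1)]|.
  apply: eq_card => -[y x]; rewrite [RHS]inE /=; apply/imsetP/idP => [[[x' y']]|Rxy].
    by rewrite inE => /= Rxy [-> ->].
  by exists (x, y); rewrite ?inE.
rewrite (card_pair_sum xpredT (fun y x => R x y)); apply: eq_bigr => y _.
rewrite -[X in _ ^ X]card_ord -card_ffun_on; apply: eq_card => x.
rewrite inE; apply: eq_forallb => a; first by rewrite inE setUC.
Qed.

Lemma card_clash x :
  #|common_nbrs x| * #|[set w | joined (x, w) && [exists b, clash x w b]]| <=
  t * (t + t * t) * #|common_nbrs x| ^ t.
Proof.
set C := common_nbrs x; pose F : {pred {ffun 'I_t -> 'I_n}} := ffun_on (mem C).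
pose B b := [set w in F | clash x w b].
have cB b : #|C| * #|B b| <= (t + t * t) * #|C| ^ t.
  rewrite -[X in _ ^ X]card_ord -card_ffun_on.
  apply: (@coordinate_swap _ _ (fun=> C) (B b) b).
    by apply/subsetP => w; rewrite inE => /andP[].
  move=> g gF.
  have := card_clash_values (g : 'I_t -> 'I_n) (fun a : 'I_t * 'I_t => x a.1)
    (fun a => x a.2) cinj.
  rewrite card_prod card_ord; apply: leq_trans.
  apply/subset_leq_card/subsetP => z; rewrite !inE => /andP[/ffun_onP wF /orP[]].
    move=> /existsP[r /andP[rb]]; rewrite !ffunE eqxx (negPf rb) eq_sym => zg.
    by apply/orP; left; apply/existsP; exists r.
  move=> /existsP[a /andP[_]]; have := wF b; rewrite !ffunE eqxx inE => /forallP zE ce.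
  by apply/orP; right; apply/existsP; exists a; rewrite zE eq_sym.
have -> : [set w | joined (x, w) && [exists b, clash x w b]] = \bigcup_b B b.
  apply/setP => w; rewrite !inE joinedE -/F; apply/andP/bigcupP => [[wF /existsP[b cb]]|[b _]].
    by exists b; rewrite // inE [w \in F]wF.
  by rewrite inE => /andP[wF cb]; split=> //; apply/existsP; exists b.
apply: (@leq_trans (\sum_b #|C| * #|B b|)).
  rewrite -big_distrr leq_mul //=.
  exact: card_bigcup_leq.
apply: (@leq_trans (\sum_(b : 'I_t) (t + t * t) * #|C| ^ t)).
  by apply: leq_sum => b _; exact: cB.
by rewrite sum_nat_const card_ord mulnA.
Qed.

(** A tuple with at least [L] common neighbors has clashes with at most a quarter
    of the tuples of its common neighbors, by [card_clash] and the choice of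
    [L].  The other tuples contribute at most [n ^ t * L ^ t] pairs altogether,
    which is less than a quarter of the joined pairs.  By the symmetry
    exchanging [x] and [w], the same holds for clashes of [x] with [w], so some
    joined pair has no clash on either side.

    Both sides are chosen at once because fixing one of them first may fail:
    every vertex on the other side can then be joined to the later vertices of
    its side in the color of one of its cross edges. *)
Lemma exists_clash_free (L := 4 * (t * (t + t * t))) :
  0 < t -> 4 * n ^ t * L ^ t < #|[set z | joined z]| ->
  exists x w, [/\ joined (x, w), forall b, ~~ clash x w b & forall b, ~~ clash w x b].
Proof.
set M := t * (t + t * t) in L *; set H := [set z | joined z] => t0 bigH.
pose D := [set z | joined z && [exists b, clash z.1 z.2 b]].
have cD : L * #|D| <= M * #|H| + n ^ t * L ^ t.+1.
  pose R (x w : {ffun 'I_t -> 'I_n}) := joined (x, w) && [exists b, clash x w b].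
  have -> : #|D| = \sum_x #|[set w | R x w]|.
    rewrite -(card_pair_sum xpredT R); apply: eq_card => -[x w]; by rewrite !inE.
  rewrite card_joined.
  have -> : n ^ t * L ^ t.+1 = \sum_(x : {ffun 'I_t -> 'I_n}) L ^ t.+1.
    by rewrite sum_nat_const card_ffun !card_ord.
  rewrite !big_distrr -big_split /=; apply: leq_sum => x _.
  have [Lx|xL] := leqP L #|common_nbrs x|.
    apply: leq_trans (leq_trans (card_clash x) (leq_addr _ _)).
    by rewrite leq_mul.
  rewrite (leq_trans _ (leq_addl _ _)) // expnS leq_mul //.
  apply: leq_trans (leq_expn2r t (ltnW xL)).
  rewrite -[X in _ ^ X]card_ord -card_ffun_on; apply/subset_leq_card/subsetP => w.
  by rewrite inE => /andP[]; rewrite joinedE.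
have [/existsP[[x w] /and3P[j /existsPn n1 /existsPn n2]]|none] :=
    boolP [exists z, [&& joined z, ~~ [exists b, clash z.1 z.2 b] &
                      ~~ [exists b, clash z.2 z.1 b]]].
  by exists x, w.
exfalso.
have HD : #|H| <= 2 * #|D|.
  pose sw (z : {ffun 'I_t -> 'I_n} * {ffun 'I_t -> 'I_n}) := (z.2, z.1).
  have swi : injective sw by move=> [a b] [a' b'] [-> ->].
  rewrite mul2n -addnn -{2}(card_imset D swi).
  apply: leq_trans (leq_card_setU _ _).
  apply/subset_leq_card/subsetP => -[x w]; rewrite !inE => j.
  move: none; rewrite negb_exists => /forallP/(_ (x, w)).
  rewrite j /= negb_and !negbK => /orP[->//|n2]; apply/orP; right.
  by apply/imsetP; exists (w, x); rewrite // inE -joined_sym j.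
have M0 : 0 < M.
  by rewrite /M; nia.
move: cD bigH HD; rewrite expnS; set h := #|H|; set d := #|D|.
set N := n ^ t; set P := L ^ t; rewrite /L -/M => cD bigH HD.
have : M * (4 * N * P) < M * h by rewrite ltn_pmul2l.
nia.
Qed.

Lemma good_config_of_clash_free x w :
  E \subset Kedges n -> joined (x, w) -> (forall b, ~~ clash x w b) -> (forall b, ~~ clash w x b) ->
  good_config c E (fun q : bool * 'I_t => q.1)
    (fun q => if q.1 then w q.2 else x q.2).
Proof.
move=> EK j xw wx.
have jE a b : [set x a; w b] \in E by have /forallP/(_ a)/forallP := j; apply.
have jE' a b : [set w b; x a] \in E by rewrite setUC.
have xw' a b : x a != w b.
  apply/eqP => ab; have := subsetP EK _ (jE a b).
  by rewrite ab setUid inE cards1.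
have inj (y z : {ffun 'I_t -> 'I_n}) : (forall b, ~~ clash y z b) -> injective z.
  move=> nc a b zab; apply/eqP/negPn/negP => ab.
  by have := nc b; rewrite negb_or => /andP[/existsPn/(_ a)]; rewrite ab zab eqxx.
have col (y z : {ffun 'I_t -> 'I_n}) : (forall b, ~~ clash y z b) ->
    forall a a' b, a != a' -> c [set y a; y a'] != c [set y a; z b].
  move=> nc a a' b aa; have := nc b; rewrite negb_or => /andP[_ /existsPn/(_ (a, a'))].
  by rewrite /= aa.
split.
- by move=> [[] a] [[] b] //= _; rewrite ?jE ?jE'.
- move=> [[] a] [[] b] /= e.
  + by rewrite (inj _ _ xw _ _ e).
  + by have := xw' b a; rewrite e eqxx.
  + by have := xw' a b; rewrite e eqxx.
  + by rewrite (inj _ _ wx _ _ e).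
by move=> [[] a] [[] b] [[] q] //; rewrite xpair_eqE //= => ab _ _; apply: col.
Qed.

End TwoSides.

(** Count the pairs of joined tuples with two applications of the power mean
    inequality, as in the theorem of Kovari, Sos and Turan: when the sum of the
    degrees exceeds a large multiple of [n ^ (2 - 1/t)], there are more than
    [4 * n ^ t * L ^ t] of them. *)
Lemma forces_of_many_colors (t : nat) : 1 < t ->
  exists C, forall n p m, p <= 2 * t -> 0 < n ->
    C * n ^ (2 * t - 1) <= m ^ t ->
    forces n (complete p) (fam_not_star t) m.
Proof.
move=> t1; pose L := 4 * (t * (t + t * t)).
exists (4 * L ^ t).+1 => n p m pt n0 Cm c mc.
have [E [EK cinj cE]] := rainbow_subset c (Kedges n).
have E2 e : e \in E -> #|e| = 2 by move/(subsetP EK); rewrite inE => /eqP.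
have nt0 k : 0 < n ^ k by rewrite expn_gt0 n0.
have Hdeg : (4 * L ^ t).+1 * n ^ (2 * t - 1) <=
    n ^ t.-1 * \sum_(x : {ffun 'I_t -> 'I_n}) #|common_nbrs E x|.
  apply: leq_trans Cm _; rewrite sum_common_nbrs.
  have := power_mean (fun y : 'I_n => #|[set x | [set y; x] \in E]|) t.-1.
  rewrite prednK ?(ltnW t1) // card_ord; apply: leq_trans.
  by rewrite sum_degrees //; apply: leq_expn2r;
  rewrite (leq_trans mc) // (leq_trans cE) // leq_pmull.
have {}Hdeg : (4 * L ^ t).+1 * n ^ t <=
    \sum_(x : {ffun 'I_t -> 'I_n}) #|common_nbrs E x|.
  rewrite -(leq_pmul2l (nt0 t.-1)) mulnCA -expnD.
  by have -> : t.-1 + t = 2 * t - 1 by lia.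
have bigH : 4 * n ^ t * L ^ t < #|[set z | joined (t := t) E z]|.
  rewrite card_joined.
  have := power_mean (fun x : {ffun 'I_t -> 'I_n} => #|common_nbrs E x|) t.-1.
  rewrite prednK ?(ltnW t1) // card_ffun !card_ord => /(leq_trans (leq_expn2r t Hdeg)).
  have N0 := nt0 t; move: N0; set N := n ^ t => N0.
  have -> : ((4 * L ^ t).+1 * N) ^ t = N ^ t.-1 * ((4 * L ^ t).+1 ^ t * N).
    by rewrite expnMn mulnCA -expnSr prednK // ltnW.
  rewrite leq_pmul2l ?expn_gt0 ?n0 // => cH; apply: leq_trans cH.
  have : (4 * L ^ t).+1 <= (4 * L ^ t).+1 ^ t.
    by rewrite -[X in X <= _]expn1 leq_pexp2l // ltnW.
  nia.
have [x [w [j xw wx]]] := exists_clash_free cinj (ltnW t1) bigH.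
have gc := good_config_of_clash_free EK j xw wx.
apply: good_config_copy t1 _ cinj _ gc.
  by rewrite card_prod card_bool card_ord.
by move=> a; rewrite card_fst_fiber.
Qed.

(** * The dense range: rainbow blow-ups of complete graphs *)

Lemma card_sum_mem (T : finType) (P : {set T}) (R : pred T) :
  #|[set y in P | R y]| = \sum_(y in P) R y.
Proof. by rewrite -sum1dep_card big_mkcondr. Qed.

Lemma exchange_card (T : finType) (P Q : {set T}) (R : rel T) :
  \sum_(x in P) #|[set y in Q | R x y]| = \sum_(y in Q) #|[set x in P | R x y]|.
Proof.
under eq_bigr do rewrite card_sum_mem; rewrite exchange_big /=.
by under [RHS]eq_bigr do rewrite card_sum_mem.
Qed.

Definition degree_in (T : finType) (A : rel T) (W : {set T}) (x : T) : nat :=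
  #|[set y in W | A x y]|.

(** Choose [W] maximizing [b * D W - a * #|W| ^ 2], where [D W] is the sum of the
    degrees inside [W].  Removing a vertex does not increase this quantity, which
    bounds its degree from below, and comparison with the whole vertex set
    shows that [W] is large. *)
Lemma dense_core (T : finType) (A : rel T) (a b : nat) :
  symmetric A -> irreflexive A ->
  a.+1 * #|T| ^ 2 <= b * \sum_x #|[set y | A x y]| ->
  exists W : {set T}, #|T| ^ 2 <= b * #|W| ^ 2 /\
    forall v, v \in W -> 2 * a * #|W| <= 2 * b * degree_in A W v + a.
Proof.
move=> As Ai dense.
pose D (W : {set T}) := \sum_(x in W) degree_in A W x.
have DT : \sum_x #|[set y | A x y]| = D setT.
  apply: eq_big => [x|x _]; first by rewrite inE.
  by apply: eq_card => y; rewrite !inE.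
have Dle W : D W <= #|W| ^ 2.
  rewrite -mulnn -sum_nat_const; apply: leq_sum => x _.
  by apply/subset_leq_card/subsetP => y; rewrite inE => /andP[].
have Wn (W : {set T}) : #|W| ^ 2 <= #|T| ^ 2 by apply: leq_expn2r; exact: max_card.
have Drem (W : {set T}) v : v \in W -> D W = D (W :\ v) + 2 * degree_in A W v.
  move=> vW; rewrite /D (big_setD1 v) //=.
  have deg1 x : x \in W :\ v -> degree_in A W x = degree_in A (W :\ v) x + A x v.
    move=> _; rewrite /degree_in (cardsD1 v) !inE vW /= addnC; congr addn.
    by apply: eq_card => y; rewrite !inE andbA.
  rewrite (eq_bigr _ deg1) big_split /= -big_mkcondr /=.
  suff -> : \sum_(x in W :\ v | A x v) 1 = degree_in A W v by lia.
  rewrite sum1dep_card; apply: eq_card => x; rewrite !inE As.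
  by have [->|] := eqVneq x v; rewrite ?Ai ?andbF.
(* The term [a * #|T| ^ 2] only keeps the potential within the naturals. *)
pose f (W : {set T}) := b * D W + a * (#|T| ^ 2 - #|W| ^ 2).
have [W _ Wmax] := @arg_maxnP {set T} setT predT f isT.
have fT := Wmax setT isT; rewrite /f cardsT subnn muln0 addn0 -DT in fT.
exists W; split.
  have := Dle W; have := Wn W; move: fT dense; rewrite /f; nia.
move=> v vW; have := Wmax (W :\ v) isT; rewrite /f (Drem _ _ vW).
have := Wn W; have := cardsD1 v W; rewrite vW /= => -> Wn'.
move: Wn'; set w := #|W :\ v|; set d := degree_in A W v; set N := #|T| ^ 2.
rewrite !expnS !expn0 => Wn' fW.
have {fW} : b * (D (W :\ v)) + a * (N - w * w) <= b * (D (W :\ v) + 2 * d) + a * (N - w.+1 * w.+1).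
  by move: fW; rewrite !muln1.
have : N - w * w = N - w.+1 * w.+1 + (2 * w + 1) by lia.
move=> ->; nia.
Qed.

Definition complete_between (T : finType) (A : rel T) : rel {set T} :=
  fun X Y => [forall x in X, forall y in Y, A x y].

Lemma complete_betweenP (T : finType) (A : rel T) (X Y : {set T}) :
  reflect {in X & Y, forall x y, A x y} (complete_between A X Y).
Proof.
apply: (iffP forall_inP) => [h x y xX yY|h x xX].
  by have /forall_inP := h x xX; apply.
by apply/forall_inP => y; apply: h.
Qed.

(** Some subset of size [s], when [X] is large enough. *)
Definition shrink (T : finType) (s : nat) (X : {set T}) : {set T} :=
  [set x in take s (enum X)].

Lemma shrink_sub (T : finType) s (X : {set T}) : shrink s X \subset X.
Proof. by apply/subsetP => x; rewrite inE => /mem_take; rewrite mem_enum. Qed.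

Lemma card_shrink (T : finType) s (X : {set T}) : s <= #|X| -> #|shrink s X| = s.
Proof.
move=> sX; rewrite cardsE.
have /card_uniqP -> : uniq (take s (enum X)) by rewrite take_uniq ?enum_uniq.
by rewrite size_takel // -cardE.
Qed.

Lemma large_fiber (T U : finType) (G : {set T}) (f : T -> U) (P : {set U}) (s : nat) :
  (forall x, x \in G -> f x \in P) -> s * #|P| < #|G| ->
  exists Z, s < #|[set x in G | f x == Z]|.
Proof.
move=> fP big; apply/existsP; apply: contraLR big.
rewrite negb_exists -leqNgt => /forallP small.
rewrite -sum1_card (partition_big f (mem P)) //= mulnC -sum_nat_const.
apply: leq_sum => Z _; rewrite sum1dep_card.
by have := small Z; rewrite -leqNgt.
Qed.

Lemma card_bigcup_seq (T : finType) (l : seq {set T}) (s : nat) :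
  (forall Y, Y \in l -> #|Y| = s) -> #|\bigcup_(Y <- l) Y| <= size l * s.
Proof.
elim: l => [|Y l IH] ls; first by rewrite big_nil cards0.
rewrite big_cons (leq_trans (leq_card_setU _ _)) // mulSn leq_add //.
  by rewrite ls ?mem_head.
by apply: IH => Z Zl; apply: ls; rewrite inE Zl orbT.
Qed.

(** The induction step of the Erdos-Stone theorem in the version of Bollobas and
    Erdos.  Take [j] sets of size [S = 2 * e * s].  Each of their vertices misses
    at most a proportion [(1 - 1/e) / r] of [W], so a positive proportion of the
    vertices of [W] has [s] neighbors in each of the [j] sets.  Among these, many
    have the same neighborhood [Z] in the union of the [j] sets; [s] of them form
    the new set, and the old ones are shrunk inside [Z]. *)
Lemma blowup_in_core (r e j : nat) : 0 < r -> 0 < e -> j <= r.+1 ->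
  forall s, 0 < s -> exists N, forall (T : finType) (A : rel T) (W : {set T}),
    symmetric A -> N <= #|W| ->
    (forall v, v \in W -> e * r * #|[set u in W | ~~ A v u]| <= e.-1 * #|W|) ->
    exists l : seq {set T},
      [/\ size l = j, (forall X, X \in l -> #|X| = s /\ X \subset W) &
          pairwise (complete_between A) l].
Proof.
move=> r0 e0; elim: j => [|j IH] jr s s0; first by exists 0 => *; exists [::].
pose S := 2 * e * s; have S0 : 0 < S by rewrite !muln_gt0 e0 s0.
have [N IHN] := IH (ltnW jr) S S0.
exists (maxn N (2 * e * (s * 2 ^ (j * S))).+1) => T A W As.
rewrite geq_max => /andP[NW bigW] core.
have [l [sl lS lA]] := IHN T A W As NW core.
pose U := \bigcup_(Y <- l) Y.
have UP y : y \in U -> exists2 Y : {set T}, Y \in l & y \in Y.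
  by rewrite /U bigcup_seq => /bigcupP[Y Yl yY]; exists Y.
have YU (Y : {set T}) : Y \in l -> Y \subset U.
  by move=> Yl; rewrite /U bigcup_seq; apply: (bigcup_sup Y).
have cU : #|U| <= j * S by rewrite -sl; apply: card_bigcup_seq => Y /lS[].
pose good := [set x in W | all (fun Y : {set T} => s <= #|[set y in Y | A x y]|) l].
pose bad := W :\: good.
have cbad : (S - s) * #|bad| <= \sum_(y in U) #|[set x in W | ~~ A y x]|.
  rewrite exchange_card mulnC -sum_nat_const.
  apply: (@leq_trans (\sum_(x in bad) #|[set y in U | ~~ A y x]|)); last first.
    rewrite [X in _ <= X](big_setID bad) /= (setIidPr _) ?leq_addr //.
    by apply: subsetDl.
  apply: leq_sum => x; rewrite !inE => /andP[nx xW]; move: nx; rewrite xW /=.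
  move=> /allPn[Y Yl]; rewrite -ltnNge => Ys.
  apply: (@leq_trans #|[set y in Y | ~~ A y x]|); last first.
    apply/subset_leq_card/subsetP => y; rewrite !inE => /andP[yY ->].
    by rewrite (subsetP (YU _ Yl)).
  have [cY _] := lS _ Yl; rewrite -cY -(cardsID [set y | A x y] Y).
  have -> : Y :&: [set y | A x y] = [set y in Y | A x y] by apply/setP => y; rewrite !inE.
  have -> : Y :\: [set y | A x y] = [set y in Y | ~~ A y x].
    by apply/setP => y; rewrite !inE As andbC.
  lia.
have cmiss : e * r * \sum_(y in U) #|[set x in W | ~~ A y x]| <= #|U| * (e.-1 * #|W|).
  rewrite big_distrr /= -sum_nat_const; apply: leq_sum => y /UP[Y Yl yY].
  by apply: core; have [_ /subsetP] := lS _ Yl; apply.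
have cgood : #|W| <= 2 * e * #|good|.
  have -> : #|good| = #|W| - #|bad|.
    have gW : good \subset W by apply/subsetP => x; rewrite inE => /andP[].
    by rewrite -(cardsID good W) (setIidPr gW) -/bad addnK.
  have : e * r * ((S - s) * #|bad|) <= r * S * (e.-1 * #|W|).
    apply: leq_trans (leq_mul (leqnn _) cbad) (leq_trans cmiss _).
    by rewrite leq_mul // (leq_trans cU) // leq_mul.
  rewrite -mulnA -[r * S * _]mulnA mulnCA leq_pmul2l // => le.
  have : (2 * e - 1) * #|bad| <= 2 * e.-1 * #|W|.
    rewrite -(@leq_pmul2l (e * s)) ?muln_gt0 ?e0 //.
    move: le; have -> : S - s = (2 * e - 1) * s by rewrite mulnBl mul1n.
    by rewrite /S; nia.
  have : e.-1.+1 = e by rewrite prednK.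
  move: e.-1 => e' <-; nia.
pose nb x := [set y in U | A x y].
have [Z /ltnW cF] : exists Z, s < #|[set x in good | nb x == Z]|.
  apply: (@large_fiber _ _ _ _ (powerset U)).
    by move=> x _; rewrite powersetE; apply/subsetP => y; rewrite inE => /andP[].
  rewrite card_powerset; apply: (@leq_ltn_trans (s * 2 ^ (j * S))).
    by rewrite leq_mul // leq_pexp2l.
  by rewrite -(@ltn_pmul2l (2 * e)) ?muln_gt0 // (leq_trans bigW).
set F := [set x in good | _] in cF.
have FZ (x : T) : x \in F -> x \in good /\ nb x = Z by rewrite !inE => /andP[-> /eqP].
have [x0 x0F] : exists x, x \in F by apply/card_gt0P; apply: leq_trans cF.
have cYZ (Y : {set T}) : Y \in l -> s <= #|Y :&: Z|.
  move=> Yl; have [] := FZ _ x0F; rewrite inE => /andP[_ /allP/(_ _ Yl) sY] <-.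
  apply: leq_trans sY _; apply/subset_leq_card/subsetP => y; rewrite !inE => /andP[yY ->].
  by rewrite yY (subsetP (YU _ Yl)).
have subF := subsetP (shrink_sub s F).
have subY (Y : {set T}) := subsetP (shrink_sub s (Y :&: Z)).
exists (shrink s F :: [seq shrink s ((Y : {set T}) :&: Z) | Y <- l]); split.
- by rewrite /= size_map sl.
- move=> X; rewrite inE => /orP[/eqP->|/mapP[Y Yl ->]].
    rewrite card_shrink //; split=> //; apply/subsetP => x /subF/FZ[].
    by rewrite inE => /andP[].
  rewrite card_shrink ?cYZ //; split=> //; apply/subsetP => y /subY /setIP[yY _].
  by have [_ /subsetP] := lS _ Yl; apply.
rewrite /= all_map; apply/andP; split.
  apply/allP => Y Yl /=; apply/complete_betweenP => x y /subF/FZ[_ nx] /subY /setIP[_].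
  by rewrite -nx inE => /andP[].
rewrite pairwise_map; apply: sub_pairwise lA => X Y /complete_betweenP XY.
apply/complete_betweenP => x y /subY/setIP[xX _] /subY/setIP[yY _].
exact: XY.
Qed.

(** Among all choices of [t] vertices in each set, a proportion at most
    [M / s] is spoiled by the coordinate [q], since the other vertices exclude at
    most [M] values of it.  As [s] exceeds [M] times the number of coordinates,
    some choice is not spoiled at all. *)
Lemma good_config_of_blowup (n t s : nat) (K : finType) (c : {set 'I_n} -> nat)
    (E : {set {set 'I_n}}) (u : K -> {set 'I_n}) (Q := (K * 'I_t)%type) :
  E \subset Kedges n -> {in E &, injective c} ->
  (forall k, #|u k| = s) ->
  (forall k k', k != k' -> {in u k & u k', forall x y, [set x; y] \in E}) ->
  #|{: Q}| * (#|{: Q}| + #|{: Q}| * #|{: Q}|) < s ->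
  exists h : Q -> 'I_n, good_config c E (fun q : Q => q.1) h.
Proof.
move=> EK cinj us uE; set M := #|{: Q}| + _ => Ms.
pose H := family (fun q : Q => mem (u q.1)).
pose clash (h : {ffun Q -> 'I_n}) q := [exists r, (r != q) && (h r == h q)] ||
  [exists ab : Q * Q, [&& ab.1 != ab.2, ab.1.1 == ab.2.1, q.1 != ab.1.1 &
     c [set h ab.1; h ab.2] == c [set h ab.1; h q]]].
pose B q := [set h | (h \in H) && clash h q].
have cB q : s * #|B q| <= M * #|H|.
  rewrite -(us q.1); apply: (@coordinate_swap _ _ (fun q => u q.1) (B q) q).
    by apply/subsetP => h; rewrite inE => /andP[].
  move=> g gF.
  have := card_clash_values (g : Q -> 'I_n) (fun ab : Q * Q => g ab.1)
    (fun ab => g ab.2) cinj.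
  rewrite [#|{: Q * Q}|]card_prod; apply: leq_trans.
  apply/subset_leq_card/subsetP => z; rewrite !inE => /andP[/familyP wF /orP[]].
    move=> /existsP[r /andP[rb]]; rewrite !ffunE eqxx (negPf rb) eq_sym => zg.
    by apply/orP; left; apply/existsP; exists r.
  move=> /existsP[[a b] /and4P[/= ab /eqP ab1 qa]].
  have bq : b != q by apply/eqP => bq; rewrite bq in ab1; rewrite ab1 eqxx in qa.
  have aq : a != q by apply/eqP => aq; rewrite aq eqxx in qa.
  rewrite !ffunE eqxx (negPf aq) (negPf bq) => ce.
  apply/orP; right; apply/existsP; exists (a, b); rewrite /= eq_sym ce andbT.
  apply: (uE a.1 q.1); first by rewrite eq_sym.
    by have := wF a; rewrite ffunE (negPf aq).
  by have := wF q; rewrite ffunE eqxx.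
have H0 : 0 < #|H|.
  have u0 k : exists x, x \in u k by apply/card_gt0P; rewrite us; apply: leq_ltn_trans Ms.
  have [f fu] := fin_all_exists u0.
  apply/card_gt0P; exists [ffun q => f q.1]; apply/familyP => q; rewrite ffunE.
  exact: fu.
have [/existsP[h /andP[hH /existsPn hc]]|none] :=
    boolP [exists h, (h \in H) && ~~ [exists q, clash h q]].
  exists h; have {}hH q : h q \in u q.1 by have /familyP := hH; apply.
  split.
  - by move=> a b ab; apply: (uE a.1 b.1).
  - move=> a b hab; apply/eqP/negPn/negP => ab.
    by have := hc b; rewrite negb_or => /andP[/existsPn/(_ a)]; rewrite ab hab eqxx.
  move=> a b q ab ab1 qa.
  have := hc q; rewrite negb_or => /andP[_ /existsPn/(_ (a, b))].
  by rewrite /= ab ab1 eqxx -ab1 qa.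
exfalso.
have HB : #|H| <= \sum_q #|B q|.
  apply: leq_trans (card_bigcup_leq _ _).
  apply/subset_leq_card/subsetP => h hH.
  move: none; rewrite negb_exists => /forallP/(_ h); rewrite hH negbK => /existsP[q hq].
  by apply/bigcupP; exists q; rewrite // inE hH.
have : s * #|H| <= #|{: Q}| * (M * #|H|).
  apply: leq_trans (leq_mul (leqnn _) HB) _.
  by rewrite big_distrr -sum_nat_const; apply: leq_sum => q _; apply: cB.
by rewrite mulnA leq_pmul2r // leqNgt Ms.
Qed.

(** The hypothesis on [a] and [b] says that [a / b] exceeds [1 - 1/r], so in the
    core given by [dense_core] each vertex misses a proportion smaller than
    [1 / r], with a gap that is absorbed by taking [e = 2 * b]. *)
Lemma forces_dense (t p r a b : nat) :
  1 < t -> 0 < r -> p <= r.+1 * t -> 0 < b -> b * r.-1 < a * r ->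
  exists N, forall n m, N <= n -> a.+1 * n ^ 2 <= b * (2 * m) ->
    forces n (complete p) (fam_not_star t) m.
Proof.
move=> t1 r0 pr b0 ab; pose q := r.+1 * t; pose s := (q * (q + q * q)).+1.
have [N HN] := @blowup_in_core r (2 * b) r.+1 r0 ltac:(lia) (leqnn _) s isT.
pose N' := (maxn N (r * a)).+1.
exists (b * N') => n m nN dense c mc.
have [E [EK cinj cE]] := rainbow_subset c (Kedges n).
have E2 e : e \in E -> #|e| = 2 by move/(subsetP EK); rewrite inE => /eqP.
pose A (x y : 'I_n) := [set x; y] \in E.
have As : symmetric A by move=> x y; rewrite /A setUC.
have Ai : irreflexive A.
  by move=> x; apply/negP => /E2; rewrite setUid cards1.
have [|W [WT core]] := @dense_core _ A a b As Ai.
  rewrite card_ord sum_degrees // (leq_trans dense) // leq_mul // leq_mul //.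
  exact: leq_trans mc cE.
rewrite card_ord in WT.
have WN : N' <= #|W|.
  rewrite leqNgt; apply/negP => WN; move: WT; apply/negP; rewrite -ltnNge.
  apply: (@leq_trans ((b * N') ^ 2)); last by rewrite leq_expn2r.
  rewrite expnMn; apply: (@leq_trans (b * N' ^ 2)).
    by rewrite ltn_pmul2l // ltn_exp2r.
  by rewrite leq_mul // -{1}(expn1 b) leq_pexp2l.
have {HN}[||l [sl lS lA]] := HN _ A W As.
- by rewrite /N' in WN; lia.
- move=> v vW; have := core v vW.
  have := cardsID [set u | A v u] W.
  have -> : W :&: [set u | A v u] = [set u in W | A v u] by apply/setP => u; rewrite !inE.
  have -> : W :\: [set u | A v u] = [set u in W | ~~ A v u].
    by apply/setP => u; rewrite !inE andbC.
  have raW : r * a <= #|W| by rewrite /N' in WN; lia.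
  rewrite /degree_in; move: #|[set u in W | A v u]| #|[set u in W | ~~ A v u]| => d x.
  move: raW; set w := #|W| => raW dx cv.
  have r1 : r.-1.+1 = r by rewrite prednK.
  have h1 : r * (2 * a * w) <= r * (2 * b * d + a) by rewrite leq_mul.
  have h2 : (b * r.-1).+1 * w <= a * r * w by rewrite leq_mul.
  have h3 : b * r * w = b * r.-1 * w + b * w by rewrite -{1}r1 mulnS mulnDl addnC.
  have h4 : b * r * w = b * r * d + b * r * x by rewrite -mulnDr dx.
  have -> : (2 * b).-1 * w = 2 * (b * w) - w by rewrite -subn1 mulnBl mul1n mulnA.
  move: h1 h2; rewrite mulSn => h1 h2.
  move: raW h1 h2 h3 h4; clear; move: (r.-1) => r'; clear; lia.
pose u (k : 'I_r.+1) := nth set0 l k.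
have ul k : u k \in l by rewrite mem_nth // sl.
have uE k k' : k != k' -> {in u k & u k', forall x y, [set x; y] \in E}.
  move=> kk; move/(pairwiseP set0): lA => lA.
  have kl (i : 'I_r.+1) : val i \in gtn (size l) by rewrite inE sl ltn_ord.
  have [lt|lt|eq] := ltngtP k k'.
  - exact: (complete_betweenP _ _ _ (lA _ _ (kl k) (kl k') lt)).
  - move=> x y xk yk; rewrite setUC.
    exact: (complete_betweenP _ _ _ (lA _ _ (kl k') (kl k) lt)).
  - by rewrite -val_eqE /= eq eqxx in kk.
have [||h gh] := @good_config_of_blowup n t s _ c E u EK cinj _ uE.
- by move=> k; have [] := lS _ (ul k).
- by rewrite card_prod !card_ord.
apply: good_config_copy t1 _ cinj _ gh; first by rewrite card_prod !card_ord.
by move=> k; rewrite card_fst_fiber.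
Qed.

(** * Turan numbers and multipartite graphs *)

Lemma card_residue (n r k : nat) : #|[set y : 'I_n | y %% r == k]| <= (n %/ r).+1.
Proof.
rewrite -[X in _ <= X]card_ord.
pose f (y : 'I_n) : 'I_(n %/ r).+1 := inord (y %/ r).
have fE y : f y = y %/ r :> nat by rewrite inordK // ltnS leq_div2r // ltnW.
rewrite -(@card_in_imset _ _ f); first exact: max_card.
move=> x y; rewrite !inE => /eqP xk /eqP yk /(congr1 val) /=; rewrite !fE => xy.
by apply: val_inj; rewrite /= (divn_eq x r) (divn_eq y r) xk yk xy.
Qed.

Lemma double_card_cross_edges (n : nat) (K : eqType) (pi : 'I_n -> K) :
  2 * #|cross_edges pi| = \sum_x #|[set y | pi x != pi y]|.
Proof.
rewrite -sum_degrees; last by move=> e; rewrite !inE => /andP[/eqP].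
by apply: eq_bigr => x _; apply: eq_card => y; rewrite [LHS]inE [RHS]inE cross_edges_pair.
Qed.

(** The graph joining the vertices with distinct residues modulo [r] contains no
    complete graph on [r + 1] vertices, by the pigeonhole principle. *)
Lemma turan_lower (n r : nat) : 0 < r ->
  r * n ^ 2 <= 2 * r * turan n (complete r.+1) + n * (n + r).
Proof.
move=> r0; pose pi (i : 'I_n) := i %% r.
apply: (@leq_trans (r * (2 * #|cross_edges pi|) + n * (n + r))).
  rewrite double_card_cross_edges big_distrr /=.
  have -> : n * (n + r) = \sum_(x : 'I_n) (n + r) by rewrite sum_nat_const card_ord.
  rewrite -big_split /= -mulnn mulnCA -{1}(card_ord n) -sum_nat_const.
  apply: leq_sum => x _.
  have := cardsID [set y | pi x != pi y] [set: 'I_n]; rewrite setTI cardsT card_ord.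
  have -> : [set: 'I_n] :\: [set y | pi x != pi y] = [set y : 'I_n | y %% r == x %% r].
    by apply/setP => y; rewrite !inE negbK andbT eq_sym.
  move=> dn; rewrite -[X in r * X]dn mulnDr leq_add2l.
  apply: leq_trans (leq_mul (leqnn r) (card_residue n r (x %% r))) _.
  by rewrite mulnS addnC leq_add2r mulnC leq_trunc_div.
rewrite leq_add2r mulnCA mulnA leq_mul //.
apply: (leq_bigmax_cond (F := fun E : {set {set 'I_n}} => #|E|)).
apply/andP; split; first by apply/subsetP => e; rewrite inE => /andP[].
apply/negP => /existsP[h /andP[hinj hE]].
have f_lt (i : 'I_r.+1) : h i %% r < r by rewrite ltn_pmod.
pose f i := Ordinal (f_lt i).
suff /leq_card : injective f by rewrite !card_ord ltnn.
move=> i j /(congr1 val) /= hij; apply/eqP/negPn/negP => ij.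
have /(subsetP hE) : [set h i; h j] \in copy_edges h.
  by apply/imsetP; exists (i, j); rewrite // inE.
by rewrite cross_edges_pair /pi hij eqxx.
Qed.

(** Erdos: a graph without a clique of size [r + 1] is dominated, degree by
    degree, by an [r]-partite graph on the same vertices.  Take a vertex [v] of maximum degree;
    its neighborhood [N] contains no clique of size [r], so induction applies to
    [N], and the vertices outside [N] form one more part.  They are then joined to all of
    [N], at least as many vertices as their degree. *)
Lemma degree_majorization (T : finType) (A : rel T) (r : nat) (W : {set T}) :
  symmetric A -> irreflexive A ->
  (forall X : {set T}, X \subset W -> #|X| = r.+1 ->
     exists x y, [/\ x \in X, y \in X, x != y & ~~ A x y]) ->
  exists pi : T -> nat, (forall x, x \in W -> pi x < r) /\
    forall x, x \in W -> degree_in A W x <= #|[set y in W | pi x != pi y]|.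
Proof.
move=> As Ai; elim: r W => [|r IH] W noK.
  exists (fun=> 0); have W0 x : x \notin W.
    apply/negP => xW; have [||a [b []]] := noK [set x]; first by rewrite sub1set.
      by rewrite cards1.
    by rewrite !inE => /eqP-> /eqP->; rewrite eqxx.
  by split=> x; rewrite (negPf (W0 x)).
have [->|[v0 v0W]] := set_0Vmem W.
  by exists (fun=> 0); split=> x; rewrite inE.
case: (@arg_maxnP _ v0 (mem W) (degree_in A W) v0W) => v vW vmax.
pose N := [set y in W | A v y].
have NW : N \subset W by apply/subsetP => y; rewrite inE => /andP[].
have vN : v \notin N by rewrite inE Ai andbF.
have [|pi [pir pid]] := IH N.
  move=> X XN cX.
  have [||x [y [xX yX xy nA]]] := noK (v |: X).
  - by rewrite subUset sub1set [v \in W]vW (subset_trans XN).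
  - by rewrite cardsU1 cX (contraNN (subsetP XN v) vN).
  have AX z : z \in X -> A v z by move/(subsetP XN); rewrite inE => /andP[].
  exists x, y; move: xX yX; rewrite !inE.
  have [xv|_] /= := eqVneq x v; have [yv|_] //= := eqVneq y v.
  - by rewrite xv yv eqxx in xy.
  - by move=> _ /AX; rewrite -xv (negPf nA).
  - by move=> /AX; rewrite -yv As (negPf nA).
exists (fun x => if x \in N then pi x else r); split.
  by move=> x _; case: ifP => // /pir; lia.
move=> x xW; case: ifP => xN; last first.
  apply: leq_trans (_ : degree_in A W v <= _); first exact: vmax.
  apply/subset_leq_card/subsetP => y yN.
  by rewrite in_set yN (subsetP NW _ yN) neq_ltn (pir _ yN) orbT.
rewrite /degree_in -(cardsID N) -[X in _ <= X](cardsID N) leq_add //.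
  have -> : [set y in W | A x y] :&: N = [set y in N | A x y].
    by apply/setP => y; rewrite !inE; case: (y \in W); case: (A x y); case: (A v y).
  apply: leq_trans (pid x xN) _; apply/subset_leq_card/subsetP => y.
  rewrite in_set => /andP[yN pxy].
  by rewrite in_setI yN andbT in_set (subsetP NW) //= yN.
apply/subset_leq_card/subsetP => y; rewrite in_setD => /andP[yN].
rewrite in_set => /andP[yW _].
by rewrite in_setD yN in_set yW (negPf yN) neq_ltn pir.
Qed.

(** Dominate an extremal graph by an [r]-partite one: the latter has at least as
    many edges, and more than [r * t] vertices must put more than [t] of them
    into one of its parts. *)
Lemma turan_le_fnum (n p t r : nat) : 0 < t -> 0 < r -> r * t < p ->
  turan n (complete r.+1) <= fnum n (complete p) (fam_not_star t).
Proof.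
move=> t0 r0 rtp; apply/bigmax_leqP => E /andP[EK noh].
have E2 e : e \in E -> #|e| = 2 by move/(subsetP EK); rewrite inE => /eqP.
pose A (x y : 'I_n) := [set x; y] \in E.
have As : symmetric A by move=> x y; rewrite /A setUC.
have Ai : irreflexive A by move=> x; apply/negP => /E2; rewrite setUid cards1.
have [|pi [pir pid]] := @degree_majorization _ A r setT As Ai.
  move=> X _ cX.
  have [/existsP[x /existsP[y /and4P[xX yX xy nA]]]|clique] :=
    boolP [exists x, exists y, [&& x \in X, y \in X, x != y & ~~ A x y]].
    by exists x, y.
  exfalso; move: noh; rewrite -(negbK [exists h, _]) negbK => /negP; apply.
  have card_cast (i : 'I_r.+1) : i < #|X| by rewrite cX.
  apply/existsP; exists [ffun i : complete r.+1 => enum_val (Ordinal (card_cast i))].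
  apply/andP; split.
    apply/injectiveP => i j; rewrite !ffunE => /enum_val_inj/(congr1 val)/= ij.
    exact: val_inj.
  apply/subsetP => e /imsetP[[i j]]; rewrite inE /= => ij ->; rewrite !ffunE.
  apply/negPn/negP => nA; case/negP: clique.
  apply/existsP; exists (enum_val (Ordinal (card_cast i))).
  apply/existsP; exists (enum_val (Ordinal (card_cast j))).
  rewrite !enum_valP nA andbT; apply: contraNN ij => /eqP/enum_val_inj/(congr1 val)/= ij.
  by apply/eqP/val_inj.
apply: ltnW; apply: (@leq_ltn_trans #|cross_edges pi|).
  rewrite -(leq_pmul2l (m := 2)) // double_card_cross_edges -(sum_degrees E2).
  apply: leq_sum => x _; have := pid x; rewrite inE => /(_ isT).
  rewrite /degree_in; congr (_ <= _); apply: eq_card => y; by rewrite !inE.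
apply: card_cross_lt_fnum => // X cX.
have [||k kX] := @large_fiber _ 'I_r.-1.+1 X (fun x => inord (pi x)) setT t.
- by [].
- by rewrite cardsT card_ord prednK // cX mulnC.
exists (k : nat); apply: leq_trans kX _.
apply/subset_leq_card/subsetP => x; rewrite !inE => /andP[-> /eqP <-].
by rewrite inordK ?eqxx // prednK // pir // inE.
Qed.

(** * Bounds on the forcing number of colors *)

Lemma card_ord_lt (n s : nat) : s <= n -> #|[set x : 'I_n | x < s]| = s.
Proof.
move=> sn; have winj : injective (widen_ord sn).
  by move=> i j /(congr1 val) /= ij; apply: val_inj.
rewrite -[RHS]card_ord -(card_imset _ winj).
apply: eq_card => x; rewrite inE; apply/idP/imsetP => [xs|[i _ ->]]; last exact: (ltn_ord i).
by exists (Ordinal xs) => //; apply: val_inj.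
Qed.

(** Make [p - t - 1] vertices singleton parts and let the others form one part:
    every set of [p] vertices has at least [t + 1] in the latter. *)
Lemma fnum_lower (n p t : nat) : 1 < t -> t < p -> p <= n ->
  (p - t - 1) * (n - p + t + 1) + 'C(p - t - 1, 2) + 1 <=
    fnum n (complete p) (fam_not_star t).
Proof.
move=> t1 tp pn; set s := p - t - 1; have sn : s <= n by rewrite /s; lia.
pose pi (i : 'I_n) := minn i s.
have -> : n - p + t + 1 = n - s by rewrite /s; lia.
rewrite addn1; apply: (@leq_ltn_trans #|cross_edges pi|); last first.
  apply: card_cross_lt_fnum; first exact: ltnW.
  move=> X cX; exists s; have := cardsID [set x : 'I_n | x < s] X.
  have : #|X :&: [set x : 'I_n | x < s]| <= s.
    by rewrite -[X in _ <= X](card_ord_lt sn) subset_leq_card // subsetIr.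
  have -> : [set x in X | pi x == s] = X :\: [set x : 'I_n | x < s].
    by apply/setP => x; rewrite !inE andbC /pi; congr andb; lia.
  by move: #|_ :\: _| #|_ :&: _| => d i; rewrite cX /s; lia.
rewrite -(leq_pmul2l (m := 2)) // double_card_cross_edges.
rewrite (bigID (fun x : 'I_n => x < s)) /=.
have c1 : #|[set x : 'I_n | ~~ (x < s)]| = n - s.
  transitivity #|~: [set x : 'I_n | x < s]|; first by apply: eq_card => x; rewrite !inE.
  by have := cardsC [set x : 'I_n | x < s]; rewrite card_ord card_ord_lt //; lia.
have h1 : \sum_(x : 'I_n | x < s) #|[set y | pi x != pi y]| = s * (n - 1).
  rewrite -[X in _ = X * _](card_ord_lt sn) -sum_nat_const.
  apply: eq_big => [x|x xs]; first by rewrite inE.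
  have := cardsC1 x; rewrite card_ord subn1 => <-; apply: eq_card => y.
  by rewrite !inE eq_sym -val_eqE /pi /=; lia.
have h2 : \sum_(x : 'I_n | ~~ (x < s)) #|[set y | pi x != pi y]| = (n - s) * s.
  rewrite -[X in _ = X * _]c1 -sum_nat_const.
  apply: eq_big => [x|x xs]; first by rewrite inE.
  rewrite -[RHS](card_ord_lt sn); apply: eq_card => y.
  by rewrite !inE /pi /=; lia.
rewrite h1 h2; have : 2 * 'C(s, 2) = s * (s - 1).
  by rewrite bin2 mul2n -[RHS]odd_double_half subn1 oddM;
    case: s {sn pi c1 h1 h2} => //= s; rewrite andNb.
by move: sn; nia.
Qed.

Lemma fnum_pow_bound (p t : nat) : 1 < t -> p <= 2 * t ->
  exists C, forall n, 0 < n ->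
    fnum n (complete p) (fam_not_star t) ^ t <= C * n ^ (2 * t - 1).
Proof.
move=> t1 pt; have [C HC] := forces_of_many_colors t1.
exists (2 ^ t * C).+1 => n n0; set f := fnum _ _ _.
have n1 : 0 < n ^ (2 * t - 1) by rewrite expn_gt0 n0.
case fE: f => [|[|m]]; first by rewrite exp0n ?(ltnW t1).
  by rewrite exp1n; nia.
have : ~ forces n (complete p) (fam_not_star t) m.+1.
  by apply/fnum_gt; rewrite -/f fE.
have [Cm|mC _] := leqP (C * n ^ (2 * t - 1)) (m.+1 ^ t).
  by case; apply: HC Cm.
apply: (@leq_trans ((2 * m.+1) ^ t)); first by apply: leq_expn2r; lia.
rewrite expnMn mulSn -mulnA (leq_trans _ (leq_addl _ _)) //.
by rewrite leq_mul // ltnW.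
Qed.

(** The Turan number is at least [(1 - 1/r) * n ^ 2 / 2 - O(n)], so exceeding it by
    a factor [1 + 1/(2 * q)] gives a density above [1 - 1/r] by a constant.
    [forces_dense] is applied to [a / b = (1 - 1/r) * (1 + 1/(8 * q))], which
    leaves room for the error term. *)
Lemma fnum_asymp (p t r q : nat) : 1 < t -> 1 < r -> p <= r.+1 * t -> 0 < q ->
  exists N, forall n, N <= n ->
    q * fnum n (complete p) (fam_not_star t) <= q.+1 * turan n (complete r.+1).
Proof.
move=> t1 r1 pr q0; pose Q := 2 * q; have r0 := ltnW r1.
have [||N HN] := @forces_dense t p r (r.-1 * (4 * Q + 1)) (4 * Q * r) t1 r0 pr.
- by rewrite /Q; nia.
- have : 0 < r.-1 by lia. nia.
exists (maxn N (16 * q + 8)) => n; rewrite geq_max => /andP[nN nq].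
set f := fnum _ _ _; have := turan_lower n r0; set T := turan _ _ => lT.
case fE: f => [|m]; first by rewrite muln0.
have : ~ forces n (complete p) (fam_not_star t) m by apply/fnum_gt; rewrite -/f fE.
have rr : r = r.-1.+1 by rewrite prednK.
move: lT; rewrite -mulnn => lT.
have T2q : 2 * q <= T.
  have : 4 * T * r + n * (2 * r) >= n * n * r by nia.
  nia.
have [Cm|mC _] := leqP (Q.+1 * T) (Q * m); last by rewrite /Q in mC; nia.
case; apply: HN => //.
have h1 : 4 * (2 * r * (Q.+1 * T)) <= 4 * Q * r * (2 * m) by nia.
apply: leq_trans h1.
have h2 : Q.+1 * (r * (n * n)) <= 2 * r * (Q.+1 * T) + Q.+1 * (n * (n + r)) by nia.
have h3 : 4 * Q.+1 * r * n <= r * (n * n) by rewrite /Q; nia.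
rewrite -mulnn.
move: h2 h3; move: (2 * r * (Q.+1 * T)) => S; clear -r1.
by case: r r1 => [|[|r]] //= _ h2 h3; lia.
Qed.

(** * The asymptotic statement *)

From mathcomp Require Import all_order all_algebra.
From mathcomp Require Import all_classical all_reals all_analysis.
Import Order.TTheory GRing.Theory Num.Theory.
Import numFieldNormedType.Exports.
Local Open Scope classical_set_scope.
Local Open Scope ring_scope.

Theorem theorem6p1 (R : realType) (p t : nat) (ht : (2 <= t)%N)
    (htp : (t < p)%N) :
  ((2 * t + 1 <= p)%N ->
     exists e : nat -> R, e @ \oo --> (0 : R) /\
       forall n : nat, (p <= n)%N ->
         (fnum n (complete p) (fam_not_star t))%:R =
         (1 + e n) * (turan n (complete (ceil_div p t)))%:R)
  /\
  (((t + 1 <= p)%N /\ (p <= 2 * t)%N ->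
     (fun n : nat => (fnum n (complete p) (fam_not_star t))%:R : R)
       =O_\oo (fun n : nat => n%:R `^ (2 - t%:R^-1) : R))
   /\
   forall n : nat, (p <= n)%N ->
     ((p - t - 1) * (n - p + t + 1) + 'C(p - t - 1, 2) + 1 <=
      fnum n (complete p) (fam_not_star t))%N).
Proof.
have t0 : (0 < t)%N := ltnW ht.
split; last (split; last by move=> n; apply: fnum_lower).
  move=> htp2.
  have r1 : (2 < ceil_div p t)%N by rewrite ltnNge ceil_divP // -ltnNge; lia.
  pose r := (ceil_div p t).-1; have rE : ceil_div p t = r.+1 by rewrite prednK //; lia.
  have r2 : (1 < r)%N by move: r1; rewrite rE.
  have rtp : (r * t < p)%N by rewrite ltnNge -ceil_divP // rE ltnn.
  have prt : (p <= r.+1 * t)%N by rewrite -ceil_divP // rE.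
  rewrite rE.
  pose f n := fnum n (complete p) (fam_not_star t).
  pose T n := turan n (complete r.+1).
  have Tf n : (T n <= f n)%N by apply: turan_le_fnum => //; exact: ltnW.
  have T0 n : (2 < n)%N -> (0 < T n)%N.
    move=> n2; have := turan_lower n (ltnW r2); rewrite -/(T n) -mulnn.
    by case: (T n) => //; nia.
  exists (fun n => (f n)%:R / (T n)%:R - 1); split; last first.
    move=> n pn; rewrite addrC subrK divfK // pnatr_eq0 -lt0n T0 //; lia.
  apply/cvgr0Pnorm_le => eps eps0.
  pose q := (Num.truncn eps^-1).+1.
  have qeps : q%:R^-1 <= eps.
    by rewrite -[leRHS]invrK lef_pV2 ?posrE ?invr_gt0 // ltW // truncnS_gt.
  have [N HN] := fnum_asymp ht r2 prt (isT : 0 < q)%N.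
  near=> n.
  have Tn : (0 < T n)%N by apply: T0; near: n; exact: nbhs_infty_gt.
  have Tn' : 0 < (T n)%:R :> R by rewrite ltr0n.
  have fT : 1 <= (f n)%:R / (T n)%:R :> R by rewrite ler_pdivlMr // mul1r ler_nat.
  rewrite ger0_norm ?subr_ge0 // (le_trans _ qeps) // lerBlDr.
  rewrite ler_pdivrMr // -(ler_pM2l (_ : 0 < q%:R)) ?ltr0n //.
  have qE : q%:R * (q%:R^-1 + 1) = q.+1%:R :> R.
    by rewrite mulrDr mulr1 divff ?pnatr_eq0 // addrC natr1.
  rewrite mulrA qE.
  rewrite -!natrM ler_nat; apply: HN.
  by near: n; exact: nbhs_infty_ge.
move=> [_ pt]; have [C HC] := fnum_pow_bound ht pt.
apply/eqO_exP; exists C.+1%:R; first by rewrite ltr0Sn.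
near=> n.
have n0 : (0 < n)%N by near: n; exact: nbhs_infty_gt.
rewrite ger0_norm ?ler0n // ger0_norm ?powR_ge0 //.
rewrite -(@ler_pXn2r _ t) ?nnegrE ?ler0n ?mulr_ge0 ?powR_ge0 //.
rewrite exprMn -[X in _ * X]powR_mulrn ?powR_ge0 // -powRrM mulrBl mulVf ?pnatr_eq0 -?lt0n //.
have -> : 2 * t%:R - 1 = (2 * t - 1)%N%:R :> R.
  by rewrite natrB ?natrM //; lia.
rewrite powR_mulrn // -!natrX -natrM ler_nat.
apply: leq_trans (HC n n0) _; rewrite leq_mul // (leq_trans (leqnSn C)) //.
by rewrite -{1}(expn1 C.+1) leq_pexp2l.
Unshelve. all: by end_near.
Qed.
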